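(* Let $X\subseteq\mathbb{R}$, let $c\in X$ be a cluster point of $X$, and let $f:X\to\mathbb{C}$. The following are equivalent: (a) The function $f$ is differentiable at $c$. (b) There is a number $L\in\mathbb{C}$ such that for all $x\in{}^*X$ with $x\approx c$, $x\neq c$ we have $$\frac{{}^*f(x)-{}^*f(c)}{x-c}\approx L.$$ (c) There is a number $L\in\mathbb{C}$ such that $\mathrm{st}\left(\frac{{}^*f(c+dx)-{}^*f(c)}{dx}\right)=L$ for all non-zero infinitesimals $dx$ such that $c+dx\in{}^*X$. Furthermore, when $L$ as in (b) exists, we have $f'(c)=L$.
   Context: $\mathbb{R}_+$ is the set of positive real numbers and $\mathbb{N}=\{1,2,3,\dots\}$. Fix an ultrafilter $\mathcal{U}$ on $\mathbb{R}_+$ such that $(0,\tfrac1n)\in\mathcal{U}$ for all $n\in\mathbb{N}$. A property of $\varepsilon\in\mathbb{R}_+$ holds almost everywhere (a.e.) if the set of $\varepsilon$ for which it holds belongs to $\mathcal{U}$. For nets $(a_\varepsilon),(b_\varepsilon)\in\mathbb{C}^{\mathbb{R}_+}$ write $(a_\varepsilon)\sim(b_\varepsilon)$ if $a_\varepsilon=b_\varepsilon$ a.e.; $\langle a_\varepsilon\rangle$ is the equivalence class, and ${}^*\mathbb{C}=\mathbb{C}^{\mathbb{R}_+}/\!\sim$ with operations induced pointwise (a field); $\mathbb{C}$ is embedded via constant nets; $|\langle z_\varepsilon\rangle|=\langle|z_\varepsilon|\rangle$. For $S\subseteq\mathbb{C}$, ${}^*S=\{\langle s_\varepsilon\rangle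 : s_\varepsilon\in S\text{ a.e.}\}$; in particular this defines ${}^*\mathbb{R}$, ordered by $\langle a_\varepsilon\rangle<\langle b_\varepsilon\rangle$ iff $a_\varepsilon<b_\varepsilon$ a.e. For $f:X\to\mathbb{C}$, ${}^*f:{}^*X\to{}^*\mathbb{C}$ is ${}^*f(\langle x_\varepsilon\rangle)=\langle f(x_\varepsilon)\rangle$, where the representative is chosen with $x_\varepsilon\in X$ for all $\varepsilon$. $z\in{}^*\mathbb{C}$ is infinitesimal if $|z|<\tfrac1n$ for all $n\in\mathbb{N}$, and finite if $|z|\le n$ for some $n\in\mathbb{N}$; $a\approx b$ means $a-b$ is infinitesimal. Here $dx$ ranges over infinitesimals of ${}^*\mathbb{R}$. For finite $x\in{}^*\mathbb{R}$, $\mathrm{st}(x)=\sup\{t\in\mathbb{R}:t\le x\}$, and for finite $x+iy$ with $x,y\in{}^*\mathbb{R}$, $\mathrm{st}(x+iy)=\mathrm{st}(x)+i\,\mathrm{st}(y)$; an equality $\mathrm{st}(w)=L$ with $L\in\mathbb{C}$ is understood to include that $w$ is finite. $f$ is differentiable at $c$ with derivative $f'(c)=L\in\mathbb{C}$ if for all $\varepsilon>0$ there is $\delta>0$ such that for all $x\in X$ with $0<|x-c|<\delta$, $\left|\frac{f(x)-f(c)}{x-c}-L\right|<\varepsilon$. *)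

(* Defs.v *)
From HB Require Import structures.
From mathcomp Require Import all_boot all_order all_algebra.
From mathcomp Require Import complex.
From mathcomp Require Import all_classical all_reals all_analysis.

Set Implicit Arguments.
Unset Strict Implicit.
Unset Printing Implicit Defensive.

Import Order.TTheory GRing.Theory Num.Theory.
Import numFieldNormedType.Exports.

Local Open Scope classical_set_scope.
Local Open Scope quotient_scope.
Local Open Scope complex_scope.
Local Open Scope ring_scope.

Section Ultrapower.
Context {I : Type} {U : set_system I} (FU : UltraFilter U) (T : choiceType).

(* With I the positive reals and U the fixed ultrafilter on them, [star FU R] *)
(* and [star FU R[i]] below are the hyperreal and hypercomplex numbers.      *)
Definition ae_eq_net (a b : I -> T) : bool := `[< \forall e \near U, a e = b e >].

Lemma ae_eq_netP (a b : I -> T) :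
  reflect (\forall e \near U, a e = b e) (ae_eq_net a b).
Proof. exact: asboolP. Qed.

Lemma ae_eq_net_refl : reflexive ae_eq_net.
Proof. by move=> a; apply/ae_eq_netP; apply: nearW. Qed.

Lemma ae_eq_net_sym : symmetric ae_eq_net.
Proof.
by move=> a b; apply/ae_eq_netP/ae_eq_netP; apply: filterS => e ->.
Qed.

Lemma ae_eq_net_trans : transitive ae_eq_net.
Proof.
move=> b a c /ae_eq_netP ab /ae_eq_netP bc; apply/ae_eq_netP.
by apply: filterS2 ab bc => e -> ->.
Qed.

Canonical ae_eq_net_equiv :=
  EquivRel ae_eq_net ae_eq_net_refl ae_eq_net_sym ae_eq_net_trans.

Definition star : Type := {eq_quot ae_eq_net_equiv}.
HB.instance Definition _ := Choice.on star.
HB.instance Definition _ := Quotient.on star.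

Definition hclass (a : I -> T) : star := \pi_star a.

Definition hconst (t : T) : star := hclass (fun=> t).

Lemma hclassK (x : star) : hclass (repr x) = x.
Proof. exact: reprK. Qed.

Lemma hclassP (a b : I -> T) :
  hclass a = hclass b <-> \forall e \near U, a e = b e.
Proof.
by split=> [/eqmodP/ae_eq_netP|ab]; last by apply/eqmodP/ae_eq_netP.
Qed.

Lemma repr_hclass (a : I -> T) : \forall e \near U, repr (hclass a) e = a e.
Proof. by apply/hclassP; rewrite hclassK. Qed.

Lemma hclassW (x : star) : exists a, x = hclass a.
Proof. by exists (repr x); rewrite hclassK. Qed.

End Ultrapower.

Section Lifts.
Context {I : Type} {U : set_system I} (FU : UltraFilter U).

Definition hmap {S T : choiceType} (g : S -> T) (x : star FU S) : star FU T :=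
  hclass FU (fun e => g (repr x e)).

Definition hmap2 {S S' T : choiceType} (g : S -> S' -> T)
    (x : star FU S) (y : star FU S') : star FU T :=
  hclass FU (fun e => g (repr x e) (repr y e)).

Definition hrel {T : choiceType} (r : rel T) (x y : star FU T) : bool :=
  `[< \forall e \near U, r (repr x e) (repr y e) >].

Lemma hmapE (S T : choiceType) (g : S -> T) (a : I -> S) :
  hmap g (hclass FU a) = hclass FU (fun e => g (a e)).
Proof. by apply/hclassP; apply: filterS (repr_hclass FU a) => e ->. Qed.

Lemma hmap2E (S S' T : choiceType) (g : S -> S' -> T) (a : I -> S)
    (b : I -> S') :
  hmap2 g (hclass FU a) (hclass FU b) = hclass FU (fun e => g (a e) (b e)).
Proof.
apply/hclassP; apply: filterS2 (repr_hclass FU a) (repr_hclass FU b).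
by move=> e -> ->.
Qed.

Lemma hrelP (T : choiceType) (r : rel T) (a b : I -> T) :
  reflect (\forall e \near U, r (a e) (b e))
          (hrel r (hclass FU a) (hclass FU b)).
Proof.
apply: (iffP (asboolP _)); apply: filterS3 (repr_hclass FU a) (repr_hclass FU b).
  by move=> e -> ->.
by move=> e <- <-.
Qed.

Lemma ultraN (P : set I) : (~ \forall e \near U, P e) ->
  \forall e \near U, ~ P e.
Proof. by case: (in_ultra_setVsetC P FU). Qed.

End Lifts.

Section StarZmodule.
Context {I : Type} {U : set_system I} (FU : UltraFilter U) (T : zmodType).
Notation starT := (star FU T).

Fact star_addA : associative (hmap2 +%R : starT -> starT -> starT).
Proof.
move=> x y z; have [a ->] := hclassW x; have [b ->] := hclassW y.
have [c ->] := hclassW z.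
rewrite (hmap2E _ +%R b c) (hmap2E _ +%R a b) !hmap2E.
by apply/hclassP; apply: nearW => e; rewrite addrA.
Qed.

Fact star_addC : commutative (hmap2 +%R : starT -> starT -> starT).
Proof.
move=> x y; have [a ->] := hclassW x; have [b ->] := hclassW y.
by rewrite !hmap2E; apply/hclassP; apply: nearW => e; rewrite addrC.
Qed.

Fact star_add0 : left_id (hconst FU 0) (hmap2 +%R : starT -> starT -> starT).
Proof.
move=> x; have [a ->] := hclassW x.
by rewrite !hmap2E; apply/hclassP; apply: nearW => e; rewrite add0r.
Qed.

Fact star_addN :
  left_inverse (hconst FU 0) (hmap -%R) (hmap2 +%R : starT -> starT -> starT).
Proof.
move=> x; have [a ->] := hclassW x.
by rewrite hmapE hmap2E; apply/hclassP; apply: nearW => e; rewrite addNr.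
Qed.

HB.instance Definition _ :=
  GRing.isZmodule.Build starT star_addA star_addC star_add0 star_addN.

End StarZmodule.

Section StarRing.
Context {I : Type} {U : set_system I} (FU : UltraFilter U) (T : comNzRingType).
Notation starT := (star FU T).

Fact star_mulA : associative (hmap2 *%R : starT -> starT -> starT).
Proof.
move=> x y z; have [a ->] := hclassW x; have [b ->] := hclassW y.
have [c ->] := hclassW z.
rewrite (hmap2E _ *%R b c) (hmap2E _ *%R a b) !hmap2E.
by apply/hclassP; apply: nearW => e; rewrite mulrA.
Qed.

Fact star_mulC : commutative (hmap2 *%R : starT -> starT -> starT).
Proof.
move=> x y; have [a ->] := hclassW x; have [b ->] := hclassW y.
by rewrite !hmap2E; apply/hclassP; apply: nearW => e; rewrite mulrC.
Qed.

Fact star_mul1 : left_id (hconst FU 1) (hmap2 *%R : starT -> starT -> starT).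
Proof.
move=> x; have [a ->] := hclassW x.
by rewrite !hmap2E; apply/hclassP; apply: nearW => e; rewrite mul1r.
Qed.

Fact star_mulDl :
  left_distributive (hmap2 *%R : starT -> starT -> starT) (hmap2 +%R).
Proof.
move=> x y z; have [a ->] := hclassW x; have [b ->] := hclassW y.
have [c ->] := hclassW z.
rewrite (hmap2E _ +%R a b) (hmap2E _ *%R a c) (hmap2E _ *%R b c) !hmap2E.
by apply/hclassP; apply: nearW => e; rewrite mulrDl.
Qed.

Fact star_1neq0 : hconst FU 1 != hconst FU 0 :> starT.
Proof.
apply/eqP => /hclassP U10; have [e] := filter_ex U10.
by apply/eqP; rewrite oner_neq0.
Qed.

HB.instance Definition _ := GRing.Zmodule_isComNzRing.Build starT
  star_mulA star_mulC star_mul1 star_mulDl star_1neq0.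

End StarRing.

Section StarField.
Context {I : Type} {U : set_system I} (FU : UltraFilter U) (T : fieldType).
Notation starT := (star FU T).

Fact star_mulVf (x : starT) : x != 0 -> hmap GRing.inv x * x = 1.
Proof.
have [a ->] := hclassW x; move=> a0; rewrite hmapE [LHS]hmap2E; apply/hclassP.
have : \forall e \near U, ~ a e = 0.
  by apply: ultraN => U0; move/eqP: a0; apply; apply/hclassP.
by apply: filterS => e /eqP ae0; rewrite mulVf.
Qed.

Fact star_inv0 : hmap GRing.inv (0 : starT) = 0.
Proof. by rewrite [LHS]hmapE; apply/hclassP; apply: nearW => e; rewrite invr0. Qed.

HB.instance Definition _ :=
  GRing.ComNzRing_isField.Build starT star_mulVf star_inv0.

End StarField.

Section StarNumField.
Context {I : Type} {U : set_system I} (FU : UltraFilter U) (T : numFieldType).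
Notation starT := (star FU T).
Let hle : rel starT := hrel <=%R.
Let hlt : rel starT := hrel <%R.
Let hnorm : starT -> starT := hmap Num.norm.

Fact star_normD (x y : starT) : hle (hnorm (x + y)) (hnorm x + hnorm y).
Proof.
have [a ->] := hclassW x; have [b ->] := hclassW y.
rewrite /hnorm [hclass FU a + _]hmap2E !hmapE [_ + _]hmap2E.
apply/hrelP.
by apply: nearW => e; apply: ler_normD.
Qed.

Fact star_addr_gt0 (x y : starT) : hlt 0 x -> hlt 0 y -> hlt 0 (x + y).
Proof.
have [a ->] := hclassW x; have [b ->] := hclassW y.
move=> /hrelP a0 /hrelP b0; rewrite ![_ + _]hmap2E; apply/hrelP.
by apply: filterS2 a0 b0 => e; apply: addr_gt0.
Qed.

Fact star_norm_eq0 (x : starT) : hnorm x = 0 -> x = 0.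
Proof.
have [a ->] := hclassW x; rewrite /hnorm hmapE => /hclassP a0; apply/hclassP.
by apply: filterS a0 => e /normr0_eq0.
Qed.

Fact star_ger_total (x y : starT) : hle 0 x -> hle 0 y -> hle x y || hle y x.
Proof.
have [a ->] := hclassW x; have [b ->] := hclassW y.
move=> /hrelP a0 /hrelP b0.
have [ab|/negP nab] := boolP (hle _ _) => //=; apply/hrelP.
have : \forall e \near U, ~ (a e <= b e).
  by apply: ultraN => ab; apply: nab; apply/hrelP.
apply: filterS3 a0 b0 => e a0 b0 /negP.
by rewrite -real_ltNge ?ger0_real// => /ltW.
Qed.

Fact star_normM : {morph hnorm : x y / x * y}.
Proof.
move=> x y; have [a ->] := hclassW x; have [b ->] := hclassW y.
rewrite /hnorm [hclass FU a * _]hmap2E !hmapE [RHS]hmap2E; apply/hclassP.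
by apply: nearW => e; apply: normrM.
Qed.

Fact star_le_def (x y : starT) : hle x y = (hnorm (y - x) == y - x).
Proof.
have [a ->] := hclassW x; have [b ->] := hclassW y.
have -> : hclass FU b - hclass FU a = hclass FU (fun e => b e - a e) :> starT.
  by rewrite [- _]hmapE [_ + _]hmap2E.
rewrite /hnorm hmapE; apply/hrelP/eqP => [ab|/hclassP ab].
  by apply/hclassP; apply: filterS ab => e; rewrite ler_def => /eqP.
by apply: filterS ab => e; rewrite ler_def => ->.
Qed.

Fact star_lt_def (x y : starT) : hlt x y = (y != x) && hle x y.
Proof.
have [a ->] := hclassW x; have [b ->] := hclassW y.
apply/hrelP/andP => [ab|[ba /hrelP ab]]; first split.
- apply/eqP => /hclassP ba; have [e [/=]] := filter_ex (filterI ab ba).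
  by move=> + bae; rewrite bae ltxx.
- by apply/hrelP; apply: filterS ab => e /ltW.
- have : \forall e \near U, ~ b e = a e.
    by apply: ultraN => U0; move/eqP: ba; apply; apply/hclassP.
  by apply: filterS2 ab => e abe /eqP; rewrite lt_def abe => ->.
Qed.

HB.instance Definition _ := Num.IntegralDomain_isNumRing.Build starT
  star_normD star_addr_gt0 star_norm_eq0 star_ger_total star_normM
  star_le_def star_lt_def.

End StarNumField.

Section StarRealField.
Context {I : Type} {U : set_system I} (FU : UltraFilter U) (T : realFieldType).
Notation starT := (star FU T).

Fact star_real : Num.real_axiom starT.
Proof.
move=> x; have [a ->] := hclassW x; rewrite realE.
have [//|/negP na] := boolP (0 <= _) => /=; apply/hrelP.
have : \forall e \near U, ~ (0 <= a e).
  by apply: ultraN => Ua; apply: na; apply/hrelP.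
by apply: filterS => e /negP; rewrite -ltNge => /ltW.
Qed.

HB.instance Definition _ := Num.NumDomain_isReal.Build starT star_real.

End StarRealField.

Section Extensions.
Context {I : Type} {U : set_system I} (FU : UltraFilter U).

Definition star_set {T : choiceType} (S : set T) : set (star FU T) :=
  [set x | exists2 s : I -> T, x = hclass FU s & \forall e \near U, S (s e)].

Lemma star_set_rep {T : choiceType} (S : set T) (x : star_set S) :
  exists s : I -> S, val x = hclass FU (fun e => val (s e)).
Proof.
case: x => x /= /set_mem[s -> Ss].
have [e0 Se0] := filter_ex Ss.
exists (fun e => match pselect (S (s e)) with
  | left Se => SigSub (mem_set Se) | right _ => SigSub (mem_set Se0) end).
by apply/hclassP; apply: filterS Ss => e Se; case: pselect.
Qed.

(* The extension of f : S -> T, computed on a representative all of whose *)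
(* values lie in S; [star_funE] is the independence of that choice.       *)
Definition star_fun {T T' : choiceType} (S : set T) (f : S -> T')
    (x : star_set S) : star FU T' :=
  hclass FU (fun e => f (projT1 (cid (star_set_rep x)) e)).

Lemma star_funE {T T' : choiceType} (S : set T) (f : S -> T')
    (x : star_set S) (s : I -> S) :
  val x = hclass FU (fun e => val (s e)) ->
  star_fun f x = hclass FU (fun e => f (s e)).
Proof.
rewrite /star_fun; case: cid => r /= -> /hclassP rs; apply/hclassP.
by apply: filterS rs => e /val_inj ->.
Qed.

Lemma hconst_in_star_set {T : choiceType} (S : set T) (c : S) :
  hconst FU (val c) \in star_set S.
Proof.
apply/mem_set; exists (fun=> val c) => //.
by apply: nearW => _; exact: set_mem (valP c).
Qed.

Definition star_pt {T : choiceType} (S : set T) (c : S) : star_set S :=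
  SigSub (hconst_in_star_set c).

End Extensions.

Arguments star_set {I U} FU {T} S.
Arguments star_fun {I U FU T T' S} f x.
Arguments star_pt {I U} FU {T S} c.

Section Infinitesimals.
Context {K : numFieldType}.

(* Stated over any ordered field with a norm, so that one definition serves *)
(* the hyperreals and the hypercomplex numbers; there [n%:R] is the class of *)
(* the constant net n, and order and norm are computed pointwise a.e.       *)
Definition infinitesimal (z : K) : Prop :=
  forall n : nat, (0 < n)%N -> `|z| < n%:R^-1.

Definition hfinite (z : K) : Prop :=
  exists2 n : nat, (0 < n)%N & `|z| <= n%:R.

Definition infinitely_close (a b : K) : Prop := infinitesimal (a - b).

End Infinitesimals.

Section StandardPart.
Context {R : realType} {I : Type} {U : set_system I} (FU : UltraFilter U).

(* The inclusion of the hyperreals into the hypercomplex numbers. *)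
Definition hcomplex : star FU R -> star FU R[i] := hmap (real_complex R).

(* Meaningful for finite arguments only. *)
Definition st (x : star FU R) : R := sup [set t : R | hconst FU t <= x].

Definition stC (z : star FU R[i]) : R[i] :=
  st (hmap (@complex.Re R) z) +i* st (hmap (@complex.Im R) z).

End StandardPart.

Section Derivative.
Context {R : realType} (X : set R) (f : X -> R[i]) (c : X).

Definition has_derivative (L : R[i]) : Prop :=
  forall eps : R, 0 < eps -> exists2 delta : R, 0 < delta &
    forall x : X, 0 < `|val x - val c| < delta ->
      `|(f x - f c) / (val x - val c)%:C - L| < eps%:C.

Definition differentiable_at : Prop := exists L : R[i], has_derivative L.

(* f'(c), unique at a limit point of X; 0 when f is not differentiable at c. *)
Definition derivative_at : R[i] := xget 0 [set L | has_derivative L].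

End Derivative.

(* Main.v *)
(* If f has derivative L, the eps-delta condition transfers pointwise to any   *)
(* net of X infinitely close to c.  Conversely, if eps admits no delta, choosing *)
(* for each index e a counterexample x_e with 0 < |x_e - c| < e gives a point   *)
(* of *X infinitely close to c (as (0, 1/n) is in U) whose difference quotient  *)
(* stays eps away from L.  The same choice at a limit point yields one          *)
(* difference quotient infinitely close to any two derivatives.  Finally        *)
(* w ~ L iff w is finite with st w = L.                                         *)
Require Import Defs.
From HB Require Import structures.
From mathcomp Require Import all_boot all_order all_algebra.
From mathcomp Require Import complex.
From mathcomp Require Import all_classical all_reals all_analysis.

Set Implicit Arguments.
Unset Strict Implicit.
Unset Printing Implicit Defensive.

Import Order.TTheory GRing.Theory Num.Theory.
Import numFieldNormedType.Exports.

Local Open Scope classical_set_scope.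
Local Open Scope complex_scope.
Local Open Scope ring_scope.

(** Each equivalence is proved for one fixed L. Every order relation in the ultrapower is an
    almost-everywhere relation between nets, so [infinitesimal_hclass] turns infinite closeness into
    one a.e. estimate for each n. This links the epsilon-delta condition with (b) in
    [has_derivativeP], the nontrivial half resting on the nets built in [exists_star_near].
    Conditions (b) and (c) differ by the substitution x = c + dx and by [infinitely_close_stCP],
    which rests on the completeness of the reals through [st_close]. The value of f'(c) then follows
    from [has_derivative_unique]. *)

Section StarOperations.
Context {I : Type} {U : set_system I} (FU : UltraFilter U).

(** * Pointwise computation in the ultrapower *)

Lemma hclassB (T : zmodType) (a b : I -> T) :
  hclass FU a - hclass FU b = hclass FU (fun e => a e - b e).
Proof. by rewrite [- _]hmapE [_ + _]hmap2E. Qed.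

Lemma hclassD (T : zmodType) (a b : I -> T) :
  hclass FU a + hclass FU b = hclass FU (fun e => a e + b e).
Proof. exact: hmap2E. Qed.

Lemma hclass_div (T : fieldType) (a b : I -> T) :
  hclass FU a / hclass FU b = hclass FU (fun e => a e / b e).
Proof. by rewrite [_^-1]hmapE [_ * _]hmap2E. Qed.

Lemma hclass_norm (T : numFieldType) (a : I -> T) :
  `|hclass FU a| = hclass FU (fun e => `|a e|).
Proof. exact: hmapE. Qed.

Lemma hclass_ltP (T : numFieldType) (a b : I -> T) :
  reflect (\forall e \near U, a e < b e) (hclass FU a < hclass FU b).
Proof. exact: hrelP. Qed.

Lemma hclass_leP (T : numFieldType) (a b : I -> T) :
  reflect (\forall e \near U, a e <= b e) (hclass FU a <= hclass FU b).
Proof. exact: hrelP. Qed.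

(** In the ultrapower [n%:R] is an iterated sum of 1, so its agreement with the constant net needs
    an induction. *)
Lemma hconst_nat (T : numFieldType) (n : nat) :
  n%:R = hconst FU n%:R :> star FU T.
Proof.
elim: n => [//|n IHn]; rewrite !mulrSr IHn.
by rewrite [LHS]hclassD.
Qed.

Lemma hconstV (T : numFieldType) (t : T) : (hconst FU t)^-1 = hconst FU t^-1.
Proof. exact: hmapE. Qed.

Lemma infinitesimal_hclass (T : numFieldType) (a : I -> T) :
  infinitesimal (hclass FU a) <->
  forall n : nat, (0 < n)%N -> \forall e \near U, `|a e| < n%:R^-1.
Proof.
rewrite /infinitesimal hclass_norm.
by split=> a0 n /a0; rewrite hconst_nat hconstV => /hclass_ltP.
Qed.

Lemma hfinite_hclass (T : numFieldType) (a : I -> T) :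
  hfinite (hclass FU a) <->
  exists2 n : nat, (0 < n)%N & \forall e \near U, `|a e| <= n%:R.
Proof.
rewrite /hfinite hclass_norm.
by split=> -[n n0 an]; exists n => //; move: an; rewrite hconst_nat => /hclass_leP.
Qed.

End StarOperations.

(** * Closure properties of infinitesimal and finite elements *)

Section Infinitesimals.
Context {K : numFieldType}.
Implicit Types x y : K.

Lemma infinitesimalN x : infinitesimal x -> infinitesimal (- x).
Proof. by move=> x0 n /x0; rewrite normrN. Qed.

Lemma infinitesimalD x y :
  infinitesimal x -> infinitesimal y -> infinitesimal (x + y).
Proof.
move=> x0 y0 n n0; have n20 : (0 < n * 2)%N by rewrite muln_gt0 n0.
apply: le_lt_trans (ler_normD _ _) _.
rewrite (splitr n%:R^-1) -invfM -natrM.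
by apply: ltrD; [exact: x0|exact: y0].
Qed.

Lemma hfinite_close x y : infinitely_close x y -> hfinite y -> hfinite x.
Proof.
move=> xy [n n0 yn]; exists n.+1 => //.
rewrite -(subrK y x) mulrSr addrC; apply: le_trans (ler_normD _ _) _.
(* The extra 1 in the bound n + 1 is infinitesimality tested at 1/1. *)
by apply: lerD => //; apply: ltW; rewrite -[ltRHS]invr1; exact: (xy 1%N).
Qed.

End Infinitesimals.

(** * Complex moduli against real and imaginary parts *)

Section ComplexBounds.
Context {R : realType}.

(** The modulus of a complex number is itself of type [R[i]], so bounds by 1/n must be moved between
    [R[i]] and [R]. *)
Lemma invnat_complex (n : nat) : n%:R^-1 = (n%:R^-1)%:C :> R[i].
Proof. by rewrite fmorphV rmorph_nat. Qed.

Lemma normci : `|'i%C| = 1 :> R[i].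
Proof. by rewrite normc_def/= expr0n add0r expr1n sqrtr1. Qed.

Lemma normc_real (x : R) : `|x%:C| = `|x|%:C.
Proof. by rewrite normc_def/= expr0n addr0 sqrtr_sqr. Qed.

Lemma normc_ge_Im (z : R[i]) : `|complex.Im z|%:C <= `|z|.
Proof.
(* Multiplication by i preserves the modulus and turns the real part into minus the imaginary
   part. *)
have := normc_ge_Re (z * 'i%C).
by rewrite ReiNIm normrN normrM normci mulr1.
Qed.

Lemma normc_le_ReIm (z : R[i]) :
  `|z| <= (`|complex.Re z| + `|complex.Im z|)%:C.
Proof.
rewrite {1}[z]complexE; apply: le_trans (ler_normD _ _) _.
by rewrite normrM normci mul1r !normc_real rmorphD.
Qed.

Lemma normc_bound (z : R[i]) : exists2 n : nat, (0 < n)%N & `|z| <= n%:R.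
Proof.
exists (Num.trunc (`|complex.Re z| + `|complex.Im z|)).+1 => //.
apply: le_trans (normc_le_ReIm _) _.
by rewrite -(rmorph_nat (real_complex R)) lecR; apply/ltW/truncnS_gt.
Qed.

Lemma exists_invnat_lt (d : R) : 0 < d ->
  exists2 n : nat, (0 < n)%N & n%:R^-1 < d.
Proof.
by move=> /ltr_add_invr[n]; rewrite add0r => nd; exists n.+1.
Qed.

End ComplexBounds.

(** * Standard parts and infinite closeness *)

Section StandardPart.
Context {R : realType} {I : Type} {U : set_system I} (FU : UltraFilter U).

Lemma hconst_le (a b : R) : (hconst FU a <= hconst FU b) = (a <= b).
Proof.
apply/hclass_leP/idP => [/filter_ex[]//|ab].
exact: nearW.
Qed.

Lemma hconst_lt (a b : R) : (hconst FU a < hconst FU b) = (a < b).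
Proof. by rewrite !ltNge hconst_le. Qed.

Lemma infinitesimal_hconst (t : R) : infinitesimal (hconst FU t) -> t = 0.
Proof.
move=> /infinitesimal_hclass t0; apply/eqP; rewrite -normr_eq0.
apply/negPn/negP => nt0.
have /exists_invnat_lt[n n0 nt] : 0 < `|t| by rewrite lt_def nt0 normr_ge0.
have /filter_ex[_] := t0 _ n0.
by move/(lt_trans nt); rewrite ltxx.
Qed.

Lemma hfinite_hconst (t : R) : hfinite (hconst FU t).
Proof.
apply/hfinite_hclass; exists (Num.trunc `|t|).+1 => //.
by apply: nearW => _; apply/ltW/truncnS_gt.
Qed.

(** Finiteness makes the set of reals below x nonempty and bounded. Within 1/m of its supremum s
    lies a member, so s - 1/m < x; and s + 1/m <= x would put s + 1/m in the set, above its
    supremum. *)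
Lemma st_close (x : star FU R) :
  hfinite x -> infinitely_close x (hconst FU (st x)).
Proof.
move=> [n n0]; rewrite hconst_nat ler_norml => /andP[nx xn] m m0.
have S_sup : has_sup [set t : R | hconst FU t <= x].
  split; first by exists (- n%:R); move: nx; rewrite /= [- hconst _ _]hmapE.
  by exists n%:R => t /= tx; rewrite -hconst_le (le_trans tx).
have mV0 : 0 < m%:R^-1 :> R by rewrite invr_gt0 ltr0n.
rewrite hconst_nat hconstV ltr_distl; apply/andP; split.
  have [t /= tx mt] := sup_adherent mV0 S_sup.
  by apply: lt_le_trans tx; rewrite [_ - _]hclassB hconst_lt.
rewrite [_ + _]hclassD ltNge; apply/negP => xm.
have := sup_upper_bound S_sup xm.
by rewrite leNgt ltrDl mV0.
Qed.

(** Both r and [st x] are infinitely close to x, and a real infinitesimal is zero. *)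
Lemma st_unique (x : star FU R) (r : R) :
  infinitely_close x (hconst FU r) -> st x = r.
Proof.
move=> xr; have /st_close xs := hfinite_close xr (hfinite_hconst r).
apply/eqP; rewrite -subr_eq0; apply/eqP/infinitesimal_hconst.
rewrite -[hconst _ _]hclassB.
have := infinitesimalD xr (infinitesimalN xs).
by rewrite opprB addrC subrKA.
Qed.

Lemma infinitesimal_ReIm (z : star FU R[i]) :
  infinitesimal z <->
  infinitesimal (hmap (@complex.Re R) z) /\
  infinitesimal (hmap (@complex.Im R) z).
Proof.
have [a ->] := hclassW z; rewrite !hmapE; split.
  move=> /infinitesimal_hclass a0.
  split; apply/infinitesimal_hclass => n /a0; apply: filterS => e;
    rewrite invnat_complex -ltcR; apply: le_lt_trans.
    exact: normc_ge_Re.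
  exact: normc_ge_Im.
move=> [/infinitesimal_hclass r0 /infinitesimal_hclass i0].
apply/infinitesimal_hclass => n n0.
have n20 : (0 < n * 2)%N by rewrite muln_gt0 n0.
apply: filterS2 (r0 _ n20) (i0 _ n20) => e re ie.
apply: le_lt_trans (normc_le_ReIm _) _.
by rewrite invnat_complex ltcR (splitr n%:R^-1) -invfM -natrM ltrD.
Qed.

Lemma hfinite_ReIm (z : star FU R[i]) : hfinite z ->
  hfinite (hmap (@complex.Re R) z) /\ hfinite (hmap (@complex.Im R) z).
Proof.
have [a ->] := hclassW z; rewrite !hmapE.
move=> /hfinite_hclass[n n0 an].
split; apply/hfinite_hclass; exists n => //; apply: filterS an => e;
  rewrite -(rmorph_nat (real_complex R)) -lecR; apply: le_trans.
  exact: normc_ge_Re.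
exact: normc_ge_Im.
Qed.

Lemma infinitely_close_ReIm (z : star FU R[i]) (L : R[i]) :
  infinitely_close z (hconst FU L) <->
  infinitely_close (hmap (@complex.Re R) z) (hconst FU (complex.Re L)) /\
  infinitely_close (hmap (@complex.Im R) z) (hconst FU (complex.Im L)).
Proof.
have [a ->] := hclassW z; rewrite /infinitely_close.
rewrite hclassB infinitesimal_ReIm !hmapE !hclassB.
suff [-> ->] : (fun e => complex.Re (a e - L)) =
      (fun e => complex.Re (a e) - complex.Re L) /\
    (fun e => complex.Im (a e - L)) =
      (fun e => complex.Im (a e) - complex.Im L) by [].
by split; apply/funext => e; case: (a e) => ? ?; case: L.
Qed.

(** This is the bridge between (b) and (c). Finiteness is recorded because [stC] is a total function
    whose value is meaningful on finite arguments only. *)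
Lemma infinitely_close_stCP (z : star FU R[i]) (L : R[i]) :
  infinitely_close z (hconst FU L) <-> hfinite z /\ stC z = L.
Proof.
split=> [zL|[/hfinite_ReIm[rz iz] <-]].
  split; last first.
    by move/infinitely_close_ReIm: zL => [/st_unique zr /st_unique zi];
      rewrite /stC zr zi; case: L {zr zi}.
  apply: hfinite_close zL _; apply/hfinite_hclass.
  by have [n n0 Ln] := normc_bound L; exists n => //; apply: nearW.
by apply/infinitely_close_ReIm; split; apply: st_close.
Qed.

End StandardPart.

(** * Derivatives through nets in X *)

Section DifferenceQuotient.
Context {R : realType} {X : set R} (f : X -> R[i]) (c : X).

Let diffq (x : X) : R[i] := (f x - f c) / (val x - val c)%:C.

Lemma star_diffqE {I : Type} {U : set_system I} (FU : UltraFilter U)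
    (x : star_set FU X) (s : I -> X) :
  val x = hclass FU (fun e => val (s e)) ->
  (star_fun f x - star_fun f (star_pt FU c))
    / hcomplex (val x - hconst FU (val c)) = hclass FU (fun e => diffq (s e)).
Proof.
move=> xs; rewrite (star_funE f xs) (@star_funE _ _ _ _ _ _ f _ (fun=> c))//.
by rewrite xs !hclassB [hcomplex _]hmapE hclass_div.
Qed.

Context {U : set_system {posnum R}} (FU : UltraFilter U).
Hypothesis U_small : forall n : nat, (0 < n)%N ->
  U [set e : {posnum R} | e%:num < n%:R^-1].

(** The indices are positive reals, so the index e itself serves as the radius for choosing x_e; by
    [U_small] these radii are a.e. below every 1/n. *)
Lemma exists_star_near (P : X -> Prop) :
  (forall d : R, 0 < d -> exists2 x : X, 0 < `|val x - val c| < d & P x) ->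
  exists (x : star_set FU X) (s : {posnum R} -> X),
    [/\ val x = hclass FU (fun e => val (s e)),
        infinitely_close (val x) (hconst FU (val c)),
        val x != hconst FU (val c) & forall e, P (s e)].
Proof.
move=> nearP.
have /choice[s sP] : forall e : {posnum R}, exists x : X,
    0 < `|val x - val c| < e%:num /\ P x.
  by move=> e; have [//|x xe Px] := nearP e%:num; exists x.
have sX : hclass FU (fun e => val (s e)) \in star_set FU X.
  apply/mem_set; exists (fun e => val (s e)) => //.
  by apply: nearW => e; exact: set_mem (valP (s e)).
exists (SigSub sX), s; split => //=; last by move=> e; have [] := sP e.
  rewrite /infinitely_close hclassB; apply/infinitesimal_hclass => n n0.
  apply: filterS (U_small n0) => e /= en.
  by have [/andP[_ /lt_trans->]] := sP e.
apply/eqP => /hclassP/filter_ex[e se].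
by have [/andP[+ _] _] := sP e; rewrite normr_gt0 subr_eq0 => /eqP/(_ se).
Qed.

Lemma has_derivativeP (L : R[i]) : has_derivative f c L <->
  forall x : star_set FU X,
    infinitely_close (val x) (hconst FU (val c)) ->
    val x != hconst FU (val c) ->
    infinitely_close ((star_fun f x - star_fun f (star_pt FU c))
              / hcomplex (val x - hconst FU (val c)))
           (hconst FU L).
Proof.
split=> [fL x + xc|fL eps eps0].
  have [s xs] := star_set_rep x.
  rewrite (star_diffqE xs) /infinitely_close xs !hclassB.
  move=> /infinitesimal_hclass sc; apply/infinitesimal_hclass => n n0.
  have [|d d0 dL] := fL n%:R^-1; first by rewrite invr_gt0 ltr0n.
  have [m m0 md] := exists_invnat_lt d0.
  (* Here the ultrafilter property is essential: failure of a.e. equality is a.e. inequality. *)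
  have s_neq : \forall e \near U, ~ val (s e) = val c.
    by apply: ultraN => s_eq; move/eqP: xc; apply; rewrite xs; apply/hclassP.
  apply: filterS2 (sc _ m0) s_neq => e sem /eqP sec.
  rewrite invnat_complex; apply: dL.
  by rewrite normr_gt0 subr_eq0 sec (lt_trans sem).
(* If eps admits no delta, every radius contains a point whose quotient misses L by at least eps.
   The resulting net does so at every index, which contradicts closeness to L at a single one. *)
apply: contrapT => no_delta.
have [d d0|x [s [xs x_close xc sP]]] :=
    @exists_star_near (fun x => ~ (`|diffq x - L| < eps%:C)).
  apply: contrapT => no_x; apply: no_delta; exists d => // x xd.
  by apply: contrapT => xL; apply: no_x; exists x.
have [n n0 neps] := exists_invnat_lt eps0.
have := fL x x_close xc.
rewrite (star_diffqE xs) /infinitely_close hclassB.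
move=> /infinitesimal_hclass/(_ _ n0)/filter_ex[e].
rewrite invnat_complex => /lt_trans sL.
by apply: (sP e); apply: sL; rewrite ltcR.
Qed.

Lemma has_derivative_unique (L L' : R[i]) : limit_point X (val c) ->
  has_derivative f c L -> has_derivative f c L' -> L = L'.
Proof.
move=> c_cluster /has_derivativeP fL /has_derivativeP fL'.
(* Being a limit point supplies one admissible x; the standard part of its quotient is both L and
   L'. *)
have [d d0|x [_ [_ x_close xc _]]] := @exists_star_near (fun=> True).
  have [y [yc Xy yd]] := c_cluster _ (nbhsx_ballx (val c) d d0).
  exists (SigSub (mem_set Xy)) => //=.
  by rewrite normr_gt0 subr_eq0 yc distrC.
have /infinitely_close_stCP[_ <-] := fL x x_close xc.
by have /infinitely_close_stCP[_ <-] := fL' x x_close xc.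
Qed.

End DifferenceQuotient.

Theorem theorem4p5p1 (R : realType)
    (U : set_system {posnum R}) (FU : UltraFilter U)
    (U_small : forall n : nat, (0 < n)%N ->
       U [set e : {posnum R} | e%:num < n%:R^-1])
    (X : set R) (c : X) (c_cluster : limit_point X (val c))
    (f : X -> R[i]) :
  let cond_b (L : R[i]) :=
    forall x : star_set FU X,
      infinitely_close (val x) (hconst FU (val c)) -> val x != hconst FU (val c) ->
      infinitely_close ((star_fun f x - star_fun f (star_pt FU c))
                / hcomplex (val x - hconst FU (val c)))
             (hconst FU L) in
  let cond_c (L : R[i]) :=
    forall dx : star FU R, infinitesimal dx -> dx != 0 ->
    forall cdx : hconst FU (val c) + dx \in star_set FU X,
      let q := (star_fun f (SigSub cdx) - star_fun f (star_pt FU c))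
                 / hcomplex dx in
      hfinite q /\ stC q = L in
  [/\ differentiable_at f c <-> (exists L : R[i], cond_b L),
      (exists L : R[i], cond_b L) <-> (exists L : R[i], cond_c L)
    & forall L : R[i], cond_b L -> derivative_at f c = L].
Proof.
move=> cond_b cond_c.
have cond_bP L : has_derivative f c L <-> cond_b L by exact: has_derivativeP.
have cond_cP L : cond_b L <-> cond_c L.
  split=> [bL dx dx0 dx_neq0 cdx q|cL x x_close xc].
    apply/infinitely_close_stCP.
    have cdxK : hconst FU (val c) + dx - hconst FU (val c) = dx.
      by rewrite addrC addKr.
    have := bL (SigSub cdx).
    rewrite /= /infinitely_close cdxK; apply => //.
    by rewrite -subr_eq0 cdxK.
  have xK : hconst FU (val c) + (val x - hconst FU (val c)) = val x.
    by rewrite addrC subrK.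
  have cdx : hconst FU (val c) + (val x - hconst FU (val c)) \in star_set FU X.
    by rewrite xK; exact: valP.
  (* With dx = x - c the point c + dx carries a new membership proof; equality of values is enough
     to identify it with x. *)
  have cdx_x : SigSub cdx = x by exact: val_inj.
  apply/infinitely_close_stCP.
  have := cL _ x_close _ cdx; rewrite /= cdx_x; apply.
  by rewrite subr_eq0.
split.
- by split=> -[L /cond_bP]; exists L.
- by split=> -[L /cond_cP]; exists L.
(* [derivative_at] picks an arbitrary derivative, so uniqueness is needed to identify it with L. *)
- move=> L /cond_bP fL; apply: xget_unique => //= L' fL'.
  exact: (has_derivative_unique FU U_small c_cluster fL' fL).
Qed.
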